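(* Let $a\in\mathbb{I}_1$. Then (1) $\ker_{\mathbb{I}_1}(\cdot a)$ and $\mathrm{coker}_{\mathbb{I}_1}(\cdot a)$ are finitely generated left $\mathbb{I}_1$-modules; (2) $\ker_{\mathbb{I}_1}(a\cdot)$ and $\mathrm{coker}_{\mathbb{I}_1}(a\cdot)$ are finitely generated right $\mathbb{I}_1$-modules.
   Context: $K$ is a field of characteristic zero. $\mathbb{I}_1$ is the subalgebra of $\mathrm{End}_K(K[x])$ generated by (multiplication by) $x$, $\partial=\frac{d}{dx}$ and $\int: x^n\mapsto \frac{x^{n+1}}{n+1}$. For $a\in\mathbb{I}_1$, $\cdot a:\mathbb{I}_1\to\mathbb{I}_1$, $b\mapsto ba$, and $a\cdot:\mathbb{I}_1\to\mathbb{I}_1$, $b\mapsto ab$; $\ker_{\mathbb{I}_1}$ and $\mathrm{coker}_{\mathbb{I}_1}$ denote the kernel and cokernel of these maps. *)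

(* Defs.v *)
From HB Require Import structures.
From mathcomp Require Import all_boot all_order all_algebra.
From mathcomp Require Import generic_quotient ring_quotient.
From mathcomp Require Import boolp.

Set Implicit Arguments.
Unset Strict Implicit.
Unset Printing Implicit Defensive.

Import GRing.Theory.
Local Open Scope ring_scope.
Local Open Scope quotient_scope.

(* Left R-modules are [lmodType R]; right R-modules are left modules over the
   converse ring, i.e., [lmodType R^c]. *)

Definition fin_gen (R : pzRingType) (M : lmodType R) : Prop :=
  exists (n : nat) (g : 'I_n -> M),
    forall m : M, exists c : 'I_n -> R, m = \sum_(i < n) c i *: g i.

Section KernelCokernel.
Variables (R : pzRingType) (M N : lmodType R) (f : {linear M -> N}).

Definition in_ker : {pred M} := fun x => f x == 0.
Definition in_img : {pred N} := fun y => `[< exists x, y = f x >].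

Lemma in_ker_closed : submod_closed in_ker.
Proof.
split=> [|a u v]; rewrite !unfold_in ?linear0 //.
by move=> /eqP fu /eqP fv; rewrite linearP fu fv scaler0 addr0.
Qed.
HB.instance Definition _ := GRing.isSubmodClosed.Build R M in_ker in_ker_closed.

Lemma in_img_closed : submod_closed in_img.
Proof.
split=> [|a u v]; first by apply/asboolP; exists 0; rewrite linear0.
move=> /asboolP[x ->] /asboolP[y ->]; apply/asboolP.
by exists (a *: x + y); rewrite linearP.
Qed.
HB.instance Definition _ := GRing.isSubmodClosed.Build R N in_img in_img_closed.

Record ker : Type := Ker { ker_val : M; _ : ker_val \in in_ker }.
HB.instance Definition _ := [isSub for ker_val].
HB.instance Definition _ := [Choice of ker by <:].
HB.instance Definition _ := [SubChoice_isSubLmodule of ker by <:].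

Definition coker : Type := Quotient.quot in_img.
HB.instance Definition _ := GRing.Zmodule.on coker.
HB.instance Definition _ := EqQuotient.on coker.
HB.instance Definition _ := ZmodQuotient.on coker.

Definition coker_scale (a : R) (x : coker) : coker :=
  \pi_coker (a *: repr x).

Lemma pi_coker_scale a (y : N) :
  coker_scale a (\pi_coker y) = \pi_coker (a *: y).
Proof.
apply/eqP; rewrite -Quotient.idealrBE -scalerBr rpredZ //.
by rewrite Quotient.idealrBE reprK.
Qed.

Lemma coker_scaleA a b x :
  coker_scale a (coker_scale b x) = coker_scale (a * b) x.
Proof.
rewrite -[x]reprK (pi_coker_scale b) (pi_coker_scale a) scalerA.
by rewrite (pi_coker_scale (a * b)).
Qed.

Lemma coker_scale1 : left_id 1 coker_scale.
Proof. by move=> x; rewrite -[x]reprK pi_coker_scale scale1r. Qed.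

Lemma coker_scaleDr : right_distributive coker_scale +%R.
Proof.
move=> a x y; rewrite -[x]reprK -[y]reprK.
by rewrite -raddfD !pi_coker_scale scalerDr raddfD.
Qed.

Lemma coker_scaleDl x : {morph coker_scale^~ x : a b / a + b}.
Proof.
by move=> a b; rewrite -[x]reprK !pi_coker_scale scalerDl raddfD.
Qed.

HB.instance Definition _ := GRing.Zmodule_isLmodule.Build R coker
  coker_scaleA coker_scale1 coker_scaleDr coker_scaleDl.

End KernelCokernel.

Section Multiplications.
Variables (R : pzRingType) (a : R).

Definition rmul_fun (b : R^o) : R^o := (b : R) * a.

Lemma rmul_fun_is_linear : linear rmul_fun.
Proof. by move=> c u v; rewrite /rmul_fun mulrDl -[c *: u]/(c * u) -mulrA. Qed.
HB.instance Definition _ := GRing.isLinear.Build R R^o R^o _ rmul_fun rmul_fun_is_linear.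

Definition lmul_fun (b : (R^c)^o) : (R^c)^o := a * (b : R).

Lemma lmul_fun_is_linear : linear lmul_fun.
Proof.
by move=> c u v; rewrite /lmul_fun mulrDr -[c *: u]/((u : R) * (c : R)) mulrA.
Qed.
HB.instance Definition _ :=
  GRing.isLinear.Build R^c (R^c)^o (R^c)^o _ lmul_fun lmul_fun_is_linear.

Definition rmul : {linear R^o -> R^o} := rmul_fun.
Definition lmul : {linear (R^c)^o -> (R^c)^o} := lmul_fun.

End Multiplications.

Section GeneratedSubalgebra.
Variables (K : pzRingType) (A : algType K) (s : seq A).

Definition in_subalg_gen : {pred A} :=
  fun u => `[< forall S : {pred A},
                 subalg_closed S -> {subset s <= S} -> u \in S >].

Lemma in_subalg_gen_closed : subalg_closed in_subalg_gen.
Proof.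
split=> [|c u v|u v]; first by apply/asboolP => S [].
  move=> /asboolP Su /asboolP Sv; apply/asboolP => S SS sS.
  by case: (SS) => _ SL _; apply: SL; [apply: Su|apply: Sv].
move=> /asboolP Su /asboolP Sv; apply/asboolP => S SS sS.
by case: (SS) => _ _ SM; apply: SM; [apply: Su|apply: Sv].
Qed.
HB.instance Definition _ :=
  GRing.isSubalgClosed.Build K A in_subalg_gen in_subalg_gen_closed.

Record subalg_gen : Type :=
  SubalgGen { subalg_val : A; _ : subalg_val \in in_subalg_gen }.
HB.instance Definition _ := [isSub for subalg_val].
HB.instance Definition _ := [Choice of subalg_gen by <:].
HB.instance Definition _ := [SubChoice_isSubAlgebra of subalg_gen by <:].

End GeneratedSubalgebra.

(* The algebra End_K(K[x]), with composition as product. *)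
Definition polyEnd (K : fieldType) : Type := {linear {poly K} -> {poly K}}.

Section PolyEnd.
Variable K : fieldType.
Local Notation E := (polyEnd K).

HB.instance Definition _ := gen_eqMixin E.
HB.instance Definition _ := gen_choiceMixin E.

Lemma polyEndP (f g : E) : (f : _ -> _) =1 g -> f = g.
Proof.
case: f g => [f [[cf] [lf]]] [g [[cg] [lg]]] /= /funext fg; subst g.
by rewrite (Prop_irrelevance cf cg) (Prop_irrelevance lf lg).
Qed.

Definition pe_zero : E := \0.
Definition pe_opp (f : E) : E := \- f.
Definition pe_add (f g : E) : E := f \+ g.
Definition pe_one : E := idfun.
Definition pe_mul (f g : E) : E := f \o g.
Definition pe_scale (c : K) (f : E) : E := c \*: f.

Lemma pe_addA : associative pe_add.
Proof. by move=> f g h; apply: polyEndP => p /=; rewrite addrA. Qed.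
Lemma pe_addC : commutative pe_add.
Proof. by move=> f g; apply: polyEndP => p /=; rewrite addrC. Qed.
Lemma pe_add0 : left_id pe_zero pe_add.
Proof. by move=> f; apply: polyEndP => p /=; rewrite add0r. Qed.
Lemma pe_addN : left_inverse pe_zero pe_opp pe_add.
Proof. by move=> f; apply: polyEndP => p /=; rewrite addNr. Qed.
HB.instance Definition _ :=
  GRing.isZmodule.Build E pe_addA pe_addC pe_add0 pe_addN.

Lemma pe_mulA : associative pe_mul.
Proof. by move=> f g h; apply: polyEndP. Qed.
Lemma pe_mul1l : left_id pe_one pe_mul.
Proof. by move=> f; apply: polyEndP. Qed.
Lemma pe_mul1r : right_id pe_one pe_mul.
Proof. by move=> f; apply: polyEndP. Qed.
Lemma pe_mulDl : left_distributive pe_mul pe_add.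
Proof. by move=> f g h; apply: polyEndP. Qed.
Lemma pe_mulDr : right_distributive pe_mul pe_add.
Proof. by move=> f g h; apply: polyEndP => p /=; rewrite linearD. Qed.
Lemma pe_one_neq0 : pe_one != pe_zero.
Proof.
apply/eqP => /(congr1 (fun f : E => f 1)) /= /eqP.
by rewrite oner_eq0.
Qed.
HB.instance Definition _ := GRing.Zmodule_isNzRing.Build E
  pe_mulA pe_mul1l pe_mul1r pe_mulDl pe_mulDr pe_one_neq0.

Lemma pe_scaleA b c f : pe_scale b (pe_scale c f) = pe_scale (b * c) f.
Proof. by apply: polyEndP => p /=; rewrite scalerA. Qed.
Lemma pe_scale1 : left_id 1 pe_scale.
Proof. by move=> f; apply: polyEndP => p /=; rewrite scale1r. Qed.
Lemma pe_scaleDr : right_distributive pe_scale +%R.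
Proof. by move=> c f g; apply: polyEndP => p /=; rewrite scalerDr. Qed.
Lemma pe_scaleDl f : {morph pe_scale^~ f : b c / b + c}.
Proof. by move=> b c; apply: polyEndP => p /=; rewrite scalerDl. Qed.
HB.instance Definition _ := GRing.Zmodule_isLmodule.Build K E
  pe_scaleA pe_scale1 pe_scaleDr pe_scaleDl.

Lemma pe_scaleAl (c : K) (f g : E) : c *: (f * g) = c *: f * g.
Proof. exact: polyEndP. Qed.
HB.instance Definition _ := GRing.Lmodule_isLalgebra.Build K E pe_scaleAl.

Lemma pe_scaleAr (c : K) (f g : E) : c *: (f * g) = f * (c *: g).
Proof. by apply: polyEndP => p /=; rewrite linearZ. Qed.
HB.instance Definition _ := GRing.Lalgebra_isAlgebra.Build K E pe_scaleAr.

Definition polyint_fun (p : {poly K}) : {poly K} :=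
  \sum_(i < size p) (p`_i / i.+1%:R) *: 'X^(i.+1).

Lemma coef_polyint_fun p i :
  (polyint_fun p)`_i = if i is j.+1 then p`_j / j.+1%:R else 0.
Proof.
rewrite /polyint_fun coef_sum; case: i => [|j].
  by rewrite big1 // => i _; rewrite coefZ coefXn mulr0.
under eq_bigr => i _ do rewrite coefZ coefXn eqSS.
have [ltj|lej] := ltnP j (size p).
  rewrite (bigD1 (Ordinal ltj)) //= eqxx mulr1 big1 ?addr0 // => i.
  by rewrite -val_eqE /= eq_sym => /negPf ->; rewrite mulr0.
rewrite nth_default // mul0r big1 // => i _.
by rewrite gtn_eqF ?mulr0 // (leq_trans (ltn_ord i)).
Qed.

Lemma polyint_fun_is_linear : linear polyint_fun.
Proof.
move=> c p q; apply/polyP => -[|i]; rewrite coefD coefZ !coef_polyint_fun.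
  by rewrite mulr0 addr0.
by rewrite coefD coefZ mulrDl mulrA.
Qed.
HB.instance Definition _ := GRing.isLinear.Build K {poly K} {poly K} _
  polyint_fun polyint_fun_is_linear.

Definition mulX_fun (p : {poly K}) : {poly K} := 'X * p.
Lemma mulX_fun_is_linear : linear mulX_fun.
Proof. by move=> c p q; rewrite /mulX_fun mulrDr scalerAr. Qed.
HB.instance Definition _ := GRing.isLinear.Build K {poly K} {poly K} _
  mulX_fun mulX_fun_is_linear.

Definition opX : E := mulX_fun.
Definition opD : E := @deriv K.
Definition opInt : E := polyint_fun.

Lemma opInt_Xn n : opInt 'X^n = n.+1%:R^-1 *: 'X^(n.+1).
Proof.
apply/polyP => -[|i]; rewrite /= coef_polyint_fun coefZ !coefXn ?mulr0 //.
by rewrite eqSS; case: eqP => [->|_]; rewrite ?mul1r ?mulr1 ?mul0r ?mulr0.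
Qed.

End PolyEnd.

(* The algebra I_1 of integro-differential operators on the affine line. *)
Definition I1 (K : fieldType) : algType K :=
  subalg_gen [:: opX K; opD K; opInt K].

(* Main.v *)
Require Import Defs.
From HB Require Import structures.
From mathcomp Require Import all_boot all_order all_algebra.
From mathcomp Require Import generic_quotient ring_quotient boolp ring zify.

(** Both cokernels are cyclic, generated by the class of 1, so only the two
    kernels matter: the left annihilator [{b | b a = 0}] and the right
    annihilator [{b | a b = 0}].  Each turns out to be generated by a single
    element.

    Right annihilator.  [a b = 0] means that the image of [b] lies in the
    subspace [ker a] of K[x].  If the algebra contains some [q] with image in
    [ker a] that fixes every vector of [ker a], then [a q = 0], and [a b = 0]
    implies [b = q b]; so [q] generates.  Such a [q] exists
    ([fixing_ker_in]) because of a dichotomy ([ker_dichotomy]): either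
    [ker a] has bounded degree, or [a] kills all large powers of x.  In both
    cases only finitely many degrees matter, and [q] is a finite matrix, or
    the identity plus a finite matrix; all finite matrices are in the algebra,
    because it contains the rank one operators [p |-> p_n v]
    ([rank1_in]).

    The dichotomy comes from a normal form ([symbol_exists]): on the divided
    powers x^[n] = x^n/n!, an element of the algebra acts, for all large n,
    as x^[n] |-> sum_k c_k(n) x^[n+k], for finitely many polynomials c_k.  If
    all c_k vanish, large powers are killed.  Otherwise the top c_k has
    finitely many roots among the natural numbers, which are distinct elements
    of K in characteristic zero, so [a] does not kill any polynomial of large
    degree.

    Left annihilator.  The bilinear form <p, q> = sum_i (i!)^2 p_i q_i, for
    which the divided powers are orthonormal, is nondegenerate, and every
    element of the algebra has an adjoint in the algebra ([adjoint_in]): those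
    of the integral, the derivative and x are the derivative, the integral and
    [opD * opX * opD].  Adjunction reverses products, hence exchanges left
    and right annihilators. *)

Set Implicit Arguments.
Unset Strict Implicit.
Unset Printing Implicit Defensive.

Import GRing.Theory.
Local Open Scope ring_scope.
Local Open Scope quotient_scope.

(** * Reduction to generators of the annihilators *)

Lemma fin_gen_coker_rmul (R : pzRingType) (a : R) : fin_gen (coker (rmul a)).
Proof.
exists 1%N, (fun=> \pi_(coker (rmul a)) (1 : R^o)) => m; exists (fun=> repr m).
rewrite big_ord1 -[LHS]reprK -[RHS]/(coker_scale _ _) pi_coker_scale.
by congr (\pi _); rewrite -[RHS]/((repr m : R) * 1) mulr1.
Qed.

Lemma fin_gen_coker_lmul (R : pzRingType) (a : R) : fin_gen (coker (lmul a)).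
Proof.
exists 1%N, (fun=> \pi_(coker (lmul a)) (1 : (R^c)^o)) => m.
exists (fun=> repr m).
rewrite big_ord1 -[LHS]reprK -[RHS]/(coker_scale _ _) pi_coker_scale.
by congr (\pi _); rewrite -[RHS]/(1 * (repr m : R)) mul1r.
Qed.

Lemma fin_gen_ker_rmul (R : pzRingType) (a q : R) :
  q * a = 0 -> (forall b, b * a = 0 -> b = b * q) -> fin_gen (ker (rmul a)).
Proof.
move=> qa0 qP; have kq : (q : R^o) \in in_ker (rmul a) by apply/eqP.
exists 1%N, (fun=> Ker kq) => -[b kb]; exists (fun=> b).
rewrite big_ord1; apply: val_inj; rewrite linearZ /=.
by apply: qP; apply/eqP.
Qed.

Lemma fin_gen_ker_lmul (R : pzRingType) (a q : R) :
  a * q = 0 -> (forall b, a * b = 0 -> b = q * b) -> fin_gen (ker (lmul a)).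
Proof.
move=> aq0 qP; have kq : (q : (R^c)^o) \in in_ker (lmul a) by apply/eqP.
exists 1%N, (fun=> Ker kq) => -[b kb]; exists (fun=> b).
rewrite big_ord1; apply: val_inj; rewrite linearZ /=.
by apply: qP; apply/eqP.
Qed.

(** * Integro-differential operators *)

Section IntegroDifferential.
Variable K : fieldType.
Local Notation E := (polyEnd K).
Local Notation opX := (opX K).
Local Notation opD := (opD K).
Local Notation opInt := (opInt K).
Local Notation inI1 := (in_subalg_gen [:: opX; opD; opInt]).

Lemma polyEndDE (f g : E) p : (f + g) p = f p + g p. Proof. by []. Qed.
Lemma polyEndNE (f : E) p : (- f) p = - f p. Proof. by []. Qed.
Lemma polyEndME (f g : E) p : (f * g) p = f (g p). Proof. by []. Qed.
Lemma polyEndZE c (f : E) p : (c *: f) p = c *: f p. Proof. by []. Qed.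
Lemma polyEnd1E p : (1 : E) p = p. Proof. by []. Qed.
Lemma polyEnd0E p : (0 : E) p = 0. Proof. by []. Qed.
Definition polyEndE :=
  (polyEndZE, polyEndDE, polyEndNE, polyEndME, polyEnd1E, polyEnd0E).

Lemma coef_opX p i : (opX p)`_i = if i is j.+1 then p`_j else 0.
Proof. by rewrite /= /mulX_fun coefXM; case: i. Qed.
Lemma coef_opD p i : (opD p)`_i = p`_i.+1 *+ i.+1.
Proof. by rewrite /= coef_deriv. Qed.
Lemma coef_opInt p i : (opInt p)`_i = if i is j.+1 then p`_j / j.+1%:R else 0.
Proof. by rewrite /= coef_polyint_fun. Qed.

Lemma opX_in : opX \in inI1.
Proof. by apply/asboolP => S _; apply; rewrite !inE eqxx. Qed.
Lemma opD_in : opD \in inI1.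
Proof. by apply/asboolP => S _; apply; rewrite !inE eqxx orbT. Qed.
Lemma opInt_in : opInt \in inI1.
Proof. by apply/asboolP => S _; apply; rewrite !inE eqxx !orbT. Qed.

(** The hypotheses only ask for stability under left multiplication by the
    generators, which is easier to check for a normal form than stability
    under products: the operators that preserve [P] by left multiplication form
    a subalgebra containing the generators. *)
Lemma I1_ind (P : E -> Prop) :
  P 1 -> (forall c f g, P f -> P g -> P (c *: f + g)) ->
  (forall f, P f -> P (opX * f)) -> (forall f, P f -> P (opD * f)) ->
  (forall f, P f -> P (opInt * f)) -> forall f, f \in inI1 -> P f.
Proof.
move=> P1 Plin PX PD PI f /asboolP If.
pose S : {pred E} := fun g => `[< forall h, P h -> P (g * h) >].
suff: f \in S by move=> /asboolP/(_ 1 P1); rewrite mulr1.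
apply: If => [|g].
  split=> [|c g h /asboolP Sg /asboolP Sh|g h /asboolP Sg /asboolP Sh].
  - by apply/asboolP => h; rewrite mul1r.
  - apply/asboolP => k Pk; rewrite mulrDl -scalerAl.
    by apply: Plin; [apply: Sg|apply: Sh].
  by apply/asboolP => k Pk; rewrite -mulrA; apply/Sg/Sh.
by rewrite !inE => /or3P[] /eqP ->; apply/asboolP.
Qed.

Hypothesis charK0 : [pchar K] =i pred0.

Let natS_neq0 n : n.+1%:R != 0 :> K.
Proof. by rewrite (pcharf0P K).1. Qed.

Let fact_neq0 n : n`!%:R != 0 :> K.
Proof. by rewrite (pcharf0P K).1 // -lt0n fact_gt0. Qed.

Let Dfact n : n.+1`!%:R = n.+1%:R * n`!%:R :> K.
Proof. by rewrite factS natrM. Qed.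

(** * Finite matrices *)

(** The constant term operator [1 - opInt * opD] has rank one, multiplication
    by x moves its image, and precomposition with the derivative moves the
    coefficient that it reads. *)
Lemma rank1_in (v : {poly K}) n :
  exists2 q : E, q \in inI1 & forall p, q p = p`_n *: v.
Proof.
elim: n => [|n [q Iq qE]]; last first.
  exists (n.+1%:R^-1 *: (q * opD)) => [|p].
    by rewrite rpredZ // rpredM // opD_in.
  by rewrite !polyEndE qE coef_opD scalerA -(mulr_natl p`__) mulKf.
elim/poly_ind: v => [|v c [q Iq qE]].
  by exists 0 => [|p]; rewrite ?rpred0 // scaler0.
exists (opX * q + c *: (1 - opInt * opD)) => [|p].
  by rewrite rpredD ?rpredZ ?rpredB ?rpredM ?rpred1 ?opX_in ?opD_in ?opInt_in.
apply/polyP => -[|i]; rewrite !polyEndE qE !(coefD, coefN, coefZ, coef_opX).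
  by rewrite coef_opInt coefMX coefC add0r /= add0r subr0 mulrC.
rewrite coef_opInt coef_opD coefMX coefC /= addr0 -(mulr_natr p`__) mulfK //.
by rewrite subrr mulr0 addr0.
Qed.

Lemma take_poly_in N :
  exists2 q : E, q \in inI1 & forall p, q p = take_poly N p.
Proof.
elim: N => [|N [q Iq qE]].
  by exists 0 => [|p]; rewrite ?rpred0 // take_poly0l.
have [r Ir rE] := rank1_in 'X^N N.
exists (q + r) => [|p]; first exact: rpredD.
rewrite polyEndE qE rE; apply/polyP => i.
rewrite coefD coefZ coefXn !coef_take_poly [in RHS]ltnS [in RHS]leq_eqVlt.
case: eqP => [->|_] /=; first by rewrite ltnn mulr1 add0r.
by rewrite mulr0 addr0.
Qed.

(** Induction on the degree bound [N]: if some [v] of degree exactly [N] is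
    killed by [a], then subtracting a multiple of [v] removes the coefficient of
    degree [N] without leaving the kernel. *)
Lemma fixing_ker_bounded_in (a : E) N :
  exists2 q : E, q \in inI1 & a * q = 0 /\
    forall p : {poly K}, (size p <= N)%N -> a p = 0 -> q p = p.
Proof.
elim: N => [|N [q Iq [aq0 qP]]].
  exists 0; rewrite ?rpred0 // mulr0; split=> // p.
  by rewrite leqn0 size_poly_eq0 => /eqP -> _; rewrite polyEndE.
have [[v szv av]|noV] :=
  pselect (exists2 v : {poly K}, size v = N.+1 & a v = 0); last first.
  exists q => //; split=> // p; rewrite leq_eqVlt => /orP[/eqP szp ap|].
    by case: noV; exists p.
  exact: qP.
have vN : v`_N != 0.
  by rewrite -[N]/(N.+1.-1) -szv -lead_coefE lead_coef_eq0 -size_poly_eq0 szv.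
have [r Ir rE] := rank1_in ((v`_N)^-1 *: v) N.
exists (q * (1 - r) + r); first by rewrite rpredD ?rpredM ?rpredB ?rpred1.
split=> [|p szp ap].
  have ar0 : a * r = 0.
    by apply: polyEndP => p; rewrite polyEndE rE !linearZ /= av !scaler0.
  by rewrite mulrDr mulrA aq0 mul0r ar0 addr0.
rewrite !polyEndE qP ?subrK // ?linearB /=; last first.
  by rewrite ap rE !linearZ /= av oppr0 !scaler0 addr0.
apply/leq_sizeP => i; rewrite leq_eqVlt => /orP[/eqP <-|ltNi].
  by rewrite coefB rE !coefZ mulVf // mulr1 subrr.
rewrite coefB rE !coefZ (leq_sizeP _ _ szp i ltNi) [v`_i]nth_default ?szv //.
by rewrite !mulr0 subrr.
Qed.

(** * The symbol of an operator *)

(** In divided powers x^[n] = x^n/n!, this says that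
    [a] sends x^[m+d] to the sum of the C_k(m) x^[m+k].  Indexing by [m] rather
    than by [m + d] avoids negative shifts. *)
Definition symbol (a : E) (d : nat) (C : {poly {poly K}}) := forall m i,
  (a 'X^(m + d))`_i * i`!%:R =
    if (m <= i)%N then (C`_(i - m)).[m%:R] * (m + d)`!%:R else 0.

Definition symb_shift (C : {poly {poly K}}) : {poly {poly K}} :=
  map_poly (comp_poly ('X + 1)) C.

Lemma symb_shiftE C j (m : nat) :
  ((symb_shift C)`_j).[m%:R] = (C`_j).[m.+1%:R].
Proof.
rewrite coef_map_id0 ?comp_poly0 // horner_comp hornerD hornerX hornerC.
by rewrite -natr1.
Qed.

(** The range of validity of a symbol can be shortened, so that two symbols can
    be brought to the same [d] and added. *)
Lemma symbolW e a d C : symbol a d C -> exists C', symbol a (e + d) C'.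
Proof.
move=> aE; elim: e => [|e [C' C'E]]; first by exists C.
exists (symb_shift C' * 'X) => m i.
rewrite addSn addnS -addSn C'E; case: (ltngtP m i) => [ltmi|//|->].
  by rewrite coefMX -(subnSK ltmi) /= symb_shiftE.
by rewrite subnn coefMX horner0 mul0r.
Qed.

Lemma symbol_exists (a : E) : a \in inI1 -> exists d C, symbol a d C.
Proof.
move: a; apply: I1_ind.
- exists 0%N, 1 => m i; rewrite addn0 polyEndE coefXn coef1 subn_eq0.
  by case: (ltngtP m i) => [||->]; rewrite ?horner0 ?mul0r // hornerC.
- move=> c a b [d [C aE]] [e [C' bE]].
  have [{}C {}aE] := symbolW e aE.
  have := symbolW d bE; rewrite addnC => -[{}C' {}bE].
  exists (e + d)%N, (c%:P *: C + C') => m i.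
  rewrite !polyEndE coefD coefZ mulrDl -mulrA aE bE.
  case: leqP => _; last by rewrite mulr0 addr0.
  by rewrite coefD coefZ hornerD hornerM hornerC mulrDl mulrA.
- move=> a [d [C aE]].
  (* x sends x^[m+k] to (m+k+1) x^[m+k+1], so the coefficient of index j is
     (m+j) C_(j-1)(m); the factor j comes from the derivative. *)
  exists d, ('X%:P * (C * 'X) + 'X * (C * 'X)^`()) => m i.
  rewrite polyEndE coef_opX; case: i => [|i].
    case: m => [|m]; rewrite mul0r //= coefD coefCM coefXM coefMX addr0.
    by rewrite mulr0 horner0 mul0r.
  rewrite Dfact mulrCA aE; case: (ltngtP m i.+1) => [ltmi|lti|->].
  + rewrite -ltnS ltmi subSn // coefD coefCM coefXM /= coef_deriv !coefMX /=.
    rewrite hornerD hornerM hornerMn hornerX mulrA; congr (_ * _).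
    rewrite -[in LHS](subnKC ltmi) subSS -(mulr_natr _.[_]); ring.
  + by rewrite leqNgt ltnW // mulr0.
  + rewrite ltnn mulr0 subnn coefD coefCM coefXM coefMX addr0 mulr0.
    by rewrite horner0 mul0r.
- move=> a [d [C aE]].
  exists d.+1, (symb_shift C) => m i.
  rewrite polyEndE coef_opD -[_ *+ i.+1]mulr_natr -mulrA -Dfact.
  rewrite addnS -addSn aE ltnS.
  by case: leqP => // _; rewrite subSS symb_shiftE.
- move=> a [d [C aE]].
  exists d, (C * 'X) => m i.
  rewrite polyEndE coef_opInt; case: i => [|i].
    by rewrite mul0r sub0n coefMX horner0 mul0r if_same.
  rewrite Dfact mulrA divfK // aE; case: (ltngtP m i.+1) => [ltmi|lti|->].
  + by rewrite -ltnS ltmi subSn // coefMX.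
  + by rewrite leqNgt ltnW.
  + by rewrite ltnn subnn coefMX horner0 mul0r.
Qed.

(** * Kernels *)

Lemma nat_nonroot (c : {poly K}) : c != 0 ->
  exists M, forall m, (M <= m)%N -> c.[m%:R] != 0.
Proof.
have [n] := ubnP (size c); elim: n c => // n IHn c szc c_neq0.
have [[m cm]|noroot] := pselect (exists m : nat, root c m%:R); last first.
  by exists 0%N => m _; apply/negP => cm; apply: noroot; exists m.
have [q cE] := factor_theorem _ _ cm.
have q_neq0 : q != 0 by apply: contra_neq c_neq0 => q0; rewrite cE q0 mul0r.
have [|M MP] := IHn q _ q_neq0.
  by move: szc; rewrite cE size_Mmonic ?monicXsubC // size_XsubC addn2.
exists (maxn M m.+1) => l; rewrite geq_max => /andP[leMl ltml].
rewrite cE hornerM mulf_neq0 ?MP // hornerXsubC -natrB ?(ltnW ltml) //.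
by rewrite (pcharf0P K).1 // -lt0n subn_gt0.
Qed.

(** The two cases are those of a nonzero and of a zero symbol. *)
Lemma ker_dichotomy (a : E) : a \in inI1 ->
  exists N, (forall p : {poly K}, a p = 0 -> (size p <= N)%N) \/
            (forall n, (N <= n)%N -> a 'X^n = 0).
Proof.
move=> /symbol_exists[d [C aE]]; have [C0|C_neq0] := eqVneq C 0.
  exists d; right=> n /subnK <-; apply/polyP => i.
  apply/(mulIf (fact_neq0 i)); rewrite aE C0 !coef0 horner0 !mul0r.
  by rewrite if_same.
have [M Mroot] : exists M, forall m, (M <= m)%N -> (lead_coef C).[m%:R] != 0.
  by apply: nat_nonroot; rewrite lead_coef_eq0.
(* B bounds the images of the powers x^j with j < d, about which the symbol
   says nothing. *)
pose B := (\max_(j < d) size (a 'X^j))%N.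
exists (maxn M B + d)%N; left=> p ap0; rewrite leqNgt; apply/negP => ltp.
pose n := ((size p).-1 - d)%N.
have szp : size p = (n + d).+1 by rewrite /n; lia.
have [leMn leBn] : (M <= n)%N /\ (B <= n)%N by lia.
pose k := (size C).-1.
(* The coefficient of a p of degree n + k is nonzero: the lead term of p is sent
   there by the lead coefficient of C, and no other term of p reaches it. *)
have /(congr1 (fun q : {poly K} => q`_(n + k) * (n + k)`!%:R)) := ap0.
rewrite coef0 mul0r -{1}[p]coefK poly_def linear_sum szp big_ord_recr /=.
rewrite coefD mulrDl linearZ coefZ -mulrA aE leq_addr addKn.
rewrite coef_sum big1 ?mul0r ?add0r => [|j _]; last first.
  rewrite linearZ coefZ; have [ltjd|ledj] := ltnP j d.
    have leB : (size (a 'X^j) <= B)%N by apply: (bigmax_sup (Ordinal ltjd)).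
    rewrite [X in _ * X]nth_default ?mulr0 //.
    exact: leq_trans leB (leq_trans leBn (leq_addr _ _)).
  have ltjn : (j - d < n)%N by have := ltn_ord j; lia.
  have := aE (j - d)%N (n + k)%N; rewrite subnK // => ajE.
  apply/(mulIf (fact_neq0 (n + k))); rewrite -mulrA ajE ifT; last by lia.
  rewrite [C`__]nth_default ?horner0 ?mul0r ?mulr0 //.
  by apply: leq_trans (leqSpred _) _; rewrite -/k; lia.
move/eqP; rewrite !mulf_eq0 -lead_coefE !(negPf (Mroot _ _)) //.
rewrite (negPf (fact_neq0 _)) !orbF -[X in p`_X]/((n + d).+1.-1) -szp.
by rewrite -lead_coefE lead_coef_eq0 -size_poly_eq0 szp.
Qed.

Lemma fixing_ker_in (a : E) : a \in inI1 ->
  exists2 q : E, q \in inI1 & a * q = 0 /\ forall p, a p = 0 -> q p = p.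
Proof.
move=> /ker_dichotomy[N kerP].
have [q Iq [aq0 qP]] := fixing_ker_bounded_in a N.
case: kerP => [bnd|a0].
  by exists q => //; split=> // p ap0; apply: qP; rewrite ?bnd.
have [t It tE] := take_poly_in N.
have at0 : a * (1 - t) = 0.
  apply: polyEndP => p; rewrite !polyEndE tE.
  rewrite -{1}(poly_take_drop N p) addrAC subrr add0r.
  rewrite -[drop_poly _ _]coefK poly_def mulr_suml linear_sum big1 // => i _.
  by rewrite -scalerAl -exprD linearZ /= a0 ?scaler0 ?leq_addl.
(* Here a kills the monomials of degree at least N, so q must fix them. *)
exists (q * t + (1 - t)); first by rewrite rpredD ?rpredM ?rpredB ?rpred1.
split=> [|p ap0]; first by rewrite mulrDr mulrA aq0 mul0r at0 addr0.
have atp : a (t p) = 0.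
  have : (a * (1 - t)) p = 0 by rewrite at0.
  rewrite polyEndME polyEndDE polyEndNE linearB ap0 sub0r => /eqP.
  by rewrite oppr_eq0 => /eqP.
rewrite !polyEndDE polyEndME polyEndNE qP //; last by rewrite tE size_take_poly.
by rewrite addrC subrK.
Qed.

(** * Adjoints *)

(** The symmetric form for which the divided powers x^n/n! are orthonormal. *)
Definition form (p q : {poly K}) : K :=
  \sum_(i < size p) (i`! ^ 2)%:R * (p`_i * q`_i).

Lemma form_widen n (p q : {poly K}) : (size p <= n)%N ->
  form p q = \sum_(i < n) (i`! ^ 2)%:R * (p`_i * q`_i).
Proof.
move=> lepn; pose F i := (i`! ^ 2)%:R * (p`_i * q`_i).
rewrite /form (big_ord_widen n F lepn) big_mkcond; apply: eq_bigr => i _.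
by case: ltnP => // lepi; rewrite /F nth_default // mul0r mulr0.
Qed.

Lemma formC p q : form p q = form q p.
Proof.
rewrite (@form_widen (size p + size q)) ?leq_addr //.
rewrite (@form_widen (size p + size q) q) ?leq_addl //.
by apply: eq_bigr => i _; rewrite [p`_i * _]mulrC.
Qed.

Lemma form_linearr c p q r : form p (c *: q + r) = c * form p q + form p r.
Proof.
rewrite mulr_sumr -big_split; apply: eq_bigr => i _ /=.
by rewrite coefD coefZ; ring.
Qed.

Lemma form_Xn n q : form 'X^n q = (n`! ^ 2)%:R * q`_n.
Proof.
rewrite /form size_polyXn big_ord_recr /= coefXn eqxx mul1r.
by rewrite big1 ?add0r // => i _; rewrite coefXn ltn_eqF ?mul0r ?mulr0.
Qed.

Lemma form_inj q r : (forall p, form p q = form p r) -> q = r.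
Proof.
move=> qr; apply/polyP => n; have := qr 'X^n; rewrite !form_Xn.
by apply: mulfI; rewrite natrX expf_neq0.
Qed.

Definition adjoint (a b : E) := forall p q, form (a p) q = form p (b q).

Lemma adjoint_sym a b : adjoint a b -> adjoint b a.
Proof. by move=> ab p q; rewrite formC -ab formC. Qed.

Lemma adjoint_inj a a' b : adjoint a b -> adjoint a' b -> a = a'.
Proof.
move=> /adjoint_sym ab /adjoint_sym ab'; apply: polyEndP => p.
by apply: form_inj => q; rewrite -ab ab'.
Qed.

Lemma adjointM a a' b b' : adjoint a a' -> adjoint b b' ->
  adjoint (a * b) (b' * a').
Proof. by move=> aa' bb' p q; rewrite !polyEndE aa' bb'. Qed.

Lemma adjoint0 : adjoint 0 0.
Proof.
by move=> p q; rewrite formC /form !big1 // => i _; rewrite coef0 !mulr0.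
Qed.

(** A shift of the index by one multiplies the weight (i!)^2 by (i+1)^2. *)
Lemma form_shift (u q p r : {poly K}) : u`_0 = 0 ->
  (forall i, u`_i.+1 * q`_i.+1 * i.+1%:R ^+ 2 = p`_i * r`_i) ->
  form u q = form p r.
Proof.
move=> u0 uqpr; have leu := leq_addr (size p) (size u).
rewrite (form_widen _ (leqW leu)) (form_widen _ (leq_addl (size u) (size p))).
rewrite big_ord_recl u0 mul0r mulr0 add0r; apply: eq_bigr => i _.
by rewrite /= -uqpr !natrX Dfact; ring.
Qed.

Lemma adjoint_Int_D : adjoint opInt opD.
Proof.
move=> p q; apply: form_shift => [|i]; rewrite coef_opInt // coef_opD.
rewrite -(mulr_natr q`__); move: i.+1%:R (natS_neq0 i) => x x0.
by field.
Qed.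

Lemma adjoint_X : adjoint opX (opD * opX * opD).
Proof.
move=> p q; apply: form_shift => [|i]; rewrite coef_opX // !polyEndME.
rewrite coef_opD coef_opX coef_opD -mulrnA mulnn -natrX.
by rewrite -(mulr_natr q`__) mulrA.
Qed.

Lemma adjoint_in a : a \in inI1 -> exists2 b, b \in inI1 & adjoint a b.
Proof.
move: a; apply: I1_ind => [|c a b [a' Ia' aa'] [b' Ib' bb']|a|a|a].
- by exists 1; rewrite ?rpred1.
- exists (c *: a' + b') => [|p q]; first by rewrite rpredD ?rpredZ.
  rewrite !polyEndE form_linearr [LHS]formC form_linearr -aa' -bb'.
  by rewrite ![form q _]formC.
- case=> b Ib ab; exists (b * (opD * opX * opD)).
    by rewrite !rpredM ?opX_in ?opD_in.
  exact: adjointM adjoint_X ab.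
- case=> b Ib ab; exists (b * opInt); first by rewrite rpredM ?opInt_in.
  exact: adjointM (adjoint_sym adjoint_Int_D) ab.
case=> b Ib ab; exists (b * opD); first by rewrite rpredM ?opD_in.
exact: adjointM adjoint_Int_D ab.
Qed.

End IntegroDifferential.

(** * Finite generation *)

Lemma val_I1M (K : fieldType) (a b : I1 K) : \val (a * b) = \val a * \val b.
Proof. exact: rmorphM. Qed.

Lemma val_I1_0 (K : fieldType) : \val (0 : I1 K) = 0.
Proof. exact: rmorph0. Qed.

Theorem theorem4p2 (K : fieldType) (charK0 : [pchar K] =i pred0) (a : I1 K) :
  (fin_gen (ker (rmul a)) /\ fin_gen (coker (rmul a))) /\
  (fin_gen (ker (lmul a)) /\ fin_gen (coker (lmul a))).
Proof.
split; [split; last exact: (fin_gen_coker_rmul a)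
      | split; last exact: (fin_gen_coker_lmul a)].
  (* The generator of the left annihilator of a is the adjoint of a generator of
     the right annihilator of the adjoint of a. *)
  have [a' Ia' aa'] := adjoint_in charK0 (valP a).
  have [q' Iq' [aq0 qP]] := fixing_ker_in charK0 Ia'.
  have [q Iq qq'] := adjoint_in charK0 Iq'.
  apply: (@fin_gen_ker_rmul _ a (SubalgGen Iq)) => [|b ba0]; apply: val_inj.
    rewrite val_I1M val_I1_0.
    apply: (adjoint_inj charK0 (b := a' * q')).
      by apply: adjointM => //; apply: adjoint_sym.
    by rewrite aq0; apply: adjoint0.
  have [b' Ib' bb'] := adjoint_in charK0 (valP b).
  have ab0 : a' * b' = 0.
    apply: (adjoint_inj charK0 (b := \val b * \val a)).
      exact/adjoint_sym/adjointM.
    by rewrite -val_I1M ba0 val_I1_0; apply: adjoint0.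
  have b'E : b' = q' * b'.
    apply: polyEndP => p; rewrite polyEndE qP //.
    by move/(congr1 (fun f : polyEnd K => f p)): ab0.
  rewrite val_I1M /=; apply: (adjoint_inj charK0 bb'); rewrite b'E.
  by apply: adjointM => //; apply: adjoint_sym.
have [q Iq [aq0 qP]] := fixing_ker_in charK0 (valP a).
apply: (@fin_gen_ker_lmul _ a (SubalgGen Iq)) => [|b ab0]; apply: val_inj.
  by rewrite val_I1M val_I1_0 /= aq0.
rewrite val_I1M /=; apply: polyEndP => p; rewrite polyEndE qP //.
move/(congr1 (fun f : I1 K => (\val f : polyEnd K) p)): ab0.
by rewrite val_I1M val_I1_0.
Qed.
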